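(* If an infinite word $\mathbf{w}$ over a finite alphabet has pseudoperiod $S=(p_1,\ldots,p_k)$, then $\mathbf{w}$ contains at most $\max S=p_k$ distinct letters. If it contains exactly $p_k$ distinct letters, then $\mathbf{w}$ has a suffix of the form $x^\omega$, where $x$ is a word of length $p_k$ containing each of these letters exactly once.
   Context: Words are indexed starting at $0$. For integers $k\ge1$ and $0<p_1<\cdots<p_k$, an infinite word $a_0a_1a_2\cdots$ has pseudoperiod $(p_1,\ldots,p_k)$ if $a_i\in\{a_{i+p_1},\ldots,a_{i+p_k}\}$ for all $i\ge0$. For a nonempty finite word $x$, $x^\omega=xxx\cdots$. *)

(* Defs.v *)
From mathcomp Require Import all_boot.
From mathcomp Require Import boolp.

Set Implicit Arguments.
Unset Strict Implicit.
Unset Printing Implicit Defensive.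

Definition infword (A : Type) := nat -> A.

(* The tuple (p_1, ..., p_k) is the sequence S; path ltn 0 S says
   0 < p_1 < ... < p_k. *)
Definition pseudoperiod_tuple (S : seq nat) : Prop :=
  S != [::] /\ path ltn 0 S.

Definition has_pseudoperiod (A : Type) (S : seq nat) (w : infword A) : Prop :=
  forall i, exists2 p, p \in S & w i = w (i + p).

Definition letters (A : finType) (w : infword A) : {set A} :=
  [set a | `[< exists i, w i = a >]].

Definition suffix_at (A : Type) (n : nat) (w : infword A) : infword A :=
  fun i => w (n + i).

(* The value does not depend on the default letter x0 when x is nonempty. *)
Definition omega_power (A : Type) (x0 : A) (x : seq A) : infword A :=
  fun i => nth x0 x (i %% size x).

(* max S = p_k *)
Lemma bigmax_last (S : seq nat) :
  pseudoperiod_tuple S -> \max_(p <- S) p = last 0 S.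
Proof.
case=> _; elim/last_ind: S => [|S p IH]; first by rewrite big_nil.
rewrite rcons_path last_rcons -cats1 big_cat big_seq1 /= => /andP[/IH -> lt_p].
exact/maxn_idPr/ltnW.
Qed.

(* Main.v *)
(** Let [m = max S]. An occurrence of a letter at position [i] forces another one
    at distance at most [m] to its right, so once a letter has occurred it occurs
    in every later window of length [m]. All windows far enough to the right thus
    contain every letter, whence there are at most [m] letters. If there are
    exactly [m], these windows have no repeated letter, so the letter at a position
    [j] cannot recur at distance less than [m], and the pseudoperiod condition at
    [j] can only hold with [p = m]. *)

Require Import Defs.
From mathcomp Require Import all_boot.
From mathcomp Require Import boolp.

Set Implicit Arguments.
Unset Strict Implicit.
Unset Printing Implicit Defensive.

Definition window (A : Type) (w : infword A) (m j : nat) : seq A :=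
  mkseq (fun k => w (j + k)) m.

Lemma mem_pseudoperiod_tuple (S : seq nat) (p : nat) :
  pseudoperiod_tuple S -> p \in S -> 0 < p <= last 0 S.
Proof.
move=> hS pS; apply/andP; split.
  by case: hS => _ /(order_path_min ltn_trans)/allP/(_ _ pS).
by rewrite -(bigmax_last hS); exact: leq_bigmax_seq.
Qed.

Lemma last_pseudoperiod_tuple_gt0 (S : seq nat) :
  pseudoperiod_tuple S -> 0 < last 0 S.
Proof.
move=> hS; have [p pS] : exists p, p \in S.
  by case: hS; case: S => // p S' _ _; exists p; rewrite mem_head.
by have /andP[/leq_trans] := mem_pseudoperiod_tuple hS pS; apply.
Qed.

(** Induction on [j - i]: sliding the window one step to the right drops only its first letter, and
    an occurrence at a positive offset merely moves one place left. *)
Lemma mem_window_later (A : eqType) (w : infword A) (S : seq nat) (i j : nat) :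
    pseudoperiod_tuple S -> has_pseudoperiod S w -> i <= j ->
  w i \in window w (last 0 S) j.
Proof.
move=> hS hw /subnKC <-; have m_gt0 := last_pseudoperiod_tuple_gt0 hS.
elim: (j - i) => [|d /mapP[k]].
  by apply/mapP; exists 0; rewrite ?mem_iota ?addn0.
rewrite mem_iota add0n => /andP[_ lt_km] ->.
case: k lt_km => [_|k lt_km]; last first.
  apply/mapP; exists k; last by rewrite addnS addnS addSn.
  by rewrite mem_iota add0n (ltnW lt_km).
(* The occurrence is the letter being dropped; its copy [p] places later has offset
   [p.-1 < last 0 S] in the new window. *)
have [p pS] := hw (i + d); have /andP[p_gt0 le_pm] := mem_pseudoperiod_tuple hS pS.
rewrite addn0 => ->; apply/mapP; exists p.-1.
  by rewrite mem_iota add0n prednK.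
by rewrite addnS addSn -addnS prednK.
Qed.

Lemma letters_seen_by (A : finType) (w : infword A) :
  exists N, forall a, a \in letters w -> exists2 i, i <= N & w i = a.
Proof.
have /choice[f fP] : forall a, exists i, a \in letters w -> w i = a.
  (* A letter that never occurs gets the dummy position 0, so that [f] is total and its maximum over
     [A] makes sense. *)
  move=> a; case: (boolP (a \in letters w)) => [|_]; last by exists 0.
  by rewrite inE => /asboolP[i wi]; exists i.
by exists (\max_a f a) => a /fP wf; exists (f a); first exact: leq_bigmax.
Qed.

Lemma letters_sub_windows (A : finType) (w : infword A) (S : seq nat) :
    pseudoperiod_tuple S -> has_pseudoperiod S w ->
  exists N, forall j, N <= j -> {subset letters w <= window w (last 0 S) j}.
Proof.
move=> hS hw; have [N seen] := letters_seen_by w.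
exists N => j le_Nj a /seen[i le_iN <-].
exact: mem_window_later hS hw (leq_trans le_iN le_Nj).
Qed.

(** Pigeonhole: [m] distinct letters fit into [m] places only without repetition. *)
Lemma window_uniq (A : finType) (w : infword A) (m j : nat) :
    {subset letters w <= window w m j} -> #|letters w| = m ->
  uniq (window w m j).
Proof.
move=> sub card_m; apply: (@leq_size_uniq _ (enum (letters w))).
- exact: enum_uniq.
- by move=> a; rewrite mem_enum => /sub.
- by rewrite size_mkseq -cardE card_m.
Qed.

Lemma shift_eq_of_window_uniq (A : eqType) (w : infword A) (S : seq nat) (j : nat) :
    pseudoperiod_tuple S -> has_pseudoperiod S w ->
    uniq (window w (last 0 S) j) ->
  w (j + last 0 S) = w j.
Proof.
move=> hS hw uniq_j; have [p pS wj] := hw j.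
have /andP[p_gt0] := mem_pseudoperiod_tuple hS pS.
rewrite leq_eqVlt => /predU1P[<- // | lt_pm].
have m_gt0 := last_pseudoperiod_tuple_gt0 hS.
(* If [p < last 0 S], the offsets 0 and [p] of one window carry the same letter, which contradicts
   [uniq_j] as [p > 0]. *)
have : nth (w j) (window w (last 0 S) j) 0 == nth (w j) (window w (last 0 S) j) p.
  by rewrite !nth_mkseq // addn0 -wj.
by rewrite nth_uniq ?size_mkseq // => /eqP p0; rewrite -p0 in p_gt0.
Qed.

Lemma suffix_omega_power (A : Type) (x0 : A) (w : infword A) (m n : nat) :
    0 < m -> (forall j, n <= j -> w (j + m) = w j) ->
  suffix_at n w =1 omega_power x0 (window w m n).
Proof.
move=> m_gt0 per i; rewrite /suffix_at /omega_power size_mkseq nth_mkseq ?ltn_mod //.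
(* Induction on the quotient strips one period [m] at a time, never going left of [n]. *)
rewrite {1}(divn_eq i m); elim: (i %/ m) => [//|q IHq].
by rewrite -IHq mulSn -addnA [m + _]addnC addnA per ?leq_addr.
Qed.

Theorem theorem4 (A : finType) (w : infword A) (S : seq nat)
    (hS : pseudoperiod_tuple S) (hw : has_pseudoperiod S w) :
  #|letters w| <= last 0 S /\
  (#|letters w| = last 0 S ->
   exists (x : seq A) (n : nat),
     [/\ size x = last 0 S,
         forall a, a \in letters w -> count_mem a x = 1
       & suffix_at n w =1 omega_power (w 0) x]).
Proof.
have [N sub] := letters_sub_windows hS hw; split.
  rewrite -[leqRHS](size_mkseq (fun k => w (N + k))) cardE.
  apply: uniq_leq_size (enum_uniq _) _ => a; rewrite mem_enum; exact: sub.
move=> card_m; have uniq_w j (le_Nj : N <= j) := window_uniq (sub j le_Nj) card_m.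
exists (window w (last 0 S) N), N; split; first exact: size_mkseq.
  (* In a word without repetition, the count of a letter is its membership bit. *)
  by move=> a /(sub N (leqnn N)) aw; rewrite count_uniq_mem ?uniq_w ?aw.
apply: suffix_omega_power (last_pseudoperiod_tuple_gt0 hS) _ => j /uniq_w.
exact: shift_eq_of_window_uniq.
Qed.
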